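(* Let $\lambda\in\mathbb{R}$. For all $p,k\in\mathbb{Z}$ with $0\le p\le k$, $$S_{2,\lambda}(k,p)=\sum_{m=p}^{k}\left\{\binom{k}{m}(-1)^{k-m}\langle 1\rangle_{k-m,\lambda}S_{2,\lambda}(m+1,p+1)+\lambda k\binom{k-1}{m}(-1)^{k-m-1}\langle 1\rangle_{k-m-1,\lambda}S_{2,\lambda}(m+1,p+1)\right\},$$ where for $m=k$ the second term inside the braces is read as $0$.
   Context: For $\lambda\in\mathbb{R}$, the generalized falling factorials are $(x)_{0,\lambda}=1$, $(x)_{n,\lambda}=x(x-\lambda)\cdots(x-(n-1)\lambda)$ for $n\ge 1$; the ordinary falling factorials are $(x)_{0}=1$, $(x)_{n}=x(x-1)\cdots(x-n+1)$ for $n\ge 1$; and the degenerate rising factorials are $\langle x\rangle_{0,\lambda}=1$, $\langle x\rangle_{n,\lambda}=x(x+\lambda)\cdots(x+(n-1)\lambda)$ for $n\ge 1$. The degenerate Stirling numbers of the second kind $S_{2,\lambda}(n,k)$, $0\le k\le n$, are defined by the polynomial identity $(x)_{n,\lambda}=\sum_{k=0}^{n}S_{2,\lambda}(n,k)(x)_{k}$ for $n\ge 0$. *)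

(* Defs.v *)
From HB Require Import structures.
From mathcomp Require Import all_boot all_order all_algebra reals ring.
Set Implicit Arguments.
Unset Strict Implicit.
Unset Printing Implicit Defensive.
Import Order.TTheory GRing.Theory Num.Theory.
Local Open Scope ring_scope.

Section DegenerateStirling.
Variable R : realType.
Implicit Types (lam x : R) (n k : nat).

(* (x)_{n,lam} as a polynomial in x *)
Definition degfall lam n : {poly R} :=
  \prod_(i < n) ('X - (i%:R * lam)%:P).

(* (x)_n as a polynomial in x *)
Definition fallp n : {poly R} := \prod_(i < n) ('X - (i%:R)%:P).

(* <x>_{n,lam} *)
Definition degrise lam x n : R := \prod_(i < n) (x + i%:R * lam).

Lemma degfall_expansion_nat lam n :
  exists c : nat -> R, degfall lam n = \sum_(k < n.+1) c k *: fallp k.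
Proof.
elim: n => [|n [c IH]].
  exists (fun=> 1); rewrite big_ord_recr big_ord0 /= add0r scale1r.
  by rewrite /degfall /fallp !big_ord0.
exists (fun k => (if k is j.+1 then c j else 0)
                 + (if (k <= n)%N then (k%:R - n%:R * lam) * c k else 0)).
under eq_bigr do rewrite scalerDl.
rewrite big_split /= big_ord_recl /= scale0r add0r.
rewrite [X in _ = _ + X]big_ord_recr /= ltnn scale0r addr0.
rewrite /degfall big_ord_recr /= -/(degfall lam n) IH mulr_suml -big_split /=.
apply: eq_bigr => k _; rewrite -ltnS ltn_ord.
rewrite /fallp big_ord_recr /= -/(fallp k) -!mul_polyC !polyCM !polyCB polyCM.
by ring.
Qed.

Lemma degfall_expansion lam n : exists c : {ffun 'I_n.+1 -> R},
  degfall lam n == \sum_(k < n.+1) c k *: fallp k.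
Proof.
have [c ->] := degfall_expansion_nat lam n.
exists [ffun k => c (val k)]; apply/eqP.
by apply: eq_bigr => k _; rewrite ffunE.
Qed.

(* S_{2,lam}(n,k) for k <= n: the coefficients, unique by degS2_unique, of
   (x)_{n,lam} in the basis of falling factorials; 0 by convention for n < k. *)
Definition degS2 lam n k : R :=
  if insub k is Some i then xchoose (degfall_expansion lam n) i else 0.

Lemma degS2P lam n :
  degfall lam n = \sum_(k < n.+1) degS2 lam n k *: fallp k.
Proof.
rewrite {1}(eqP (xchooseP (degfall_expansion lam n))).
by apply: eq_bigr => k _; rewrite /degS2 valK.
Qed.

Lemma size_fallp n : size (fallp n) = n.+1.
Proof. by rewrite /fallp size_prod_XsubC [index_enum _]unlock -enumT size_enum_ord. Qed.

Lemma monic_fallp n : fallp n \is monic.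
Proof. by apply: monic_prod => i _; apply: monicXsubC. Qed.

Lemma fallp_free n (c : nat -> R) :
  \sum_(k < n) c k *: fallp k = 0 -> forall k, (k < n)%N -> c k = 0.
Proof.
elim: n => [//|n IH]; rewrite big_ord_recr /= => H.
have sz : leq (size (\sum_(k < n) c k *: fallp k)) n.
  apply: leq_trans (size_sum _ _ _) _; apply/bigmax_leqP => k _.
  by apply: leq_trans (size_scale_leq _ _) _; rewrite size_fallp.
have cn : c n = 0.
  have /(congr1 (coefp n)) := H; rewrite /= coefD coefZ coef0.
  rewrite (nth_default 0 sz) add0r.
  have := monicP (monic_fallp n); rewrite /lead_coef size_fallp /= => ->.
  by rewrite mulr1.
move=> k; rewrite ltnS leq_eqVlt => /predU1P[-> //|]; apply: IH.
by move: H; rewrite cn scale0r addr0.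
Qed.

Lemma degS2_unique lam n (c : nat -> R) :
  degfall lam n = \sum_(k < n.+1) c k *: fallp k ->
  forall k, (k <= n)%N -> c k = degS2 lam n k.
Proof.
move=> H k le_kn; apply/eqP; rewrite -subr_eq0; apply/eqP.
apply: (@fallp_free n.+1 (fun j => c j - degS2 lam n j)) => //.
under eq_bigr do rewrite scalerBl.
by rewrite sumrB -H -degS2P subrr.
Qed.

End DegenerateStirling.

(* Main.v *)
Require Import Defs.
From mathcomp Require Import all_boot all_order all_algebra reals.
From mathcomp Require Import ring.
Import Order.TTheory GRing.Theory Num.Theory.
Local Open Scope ring_scope.

(** Write [(x)_n] for the falling factorial of step [lam].  Dividing the
    expansion of [(X)_(m+1)] by [X] and replacing [X] with [X + 1] shows that
    [p |-> S(m+1, p+1)] lists the coordinates of [(X + 1 - lam)_m] in the basis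
    of ordinary falling factorials ([gfall_shift_expansion]).  The right-hand
    side of the theorem is therefore a coordinate of a combination of the
    [(X + 1 - lam)_m], whose weights are binomials times values of
    [(-1)_j = (-1)^j <1>_j].  By the Vandermonde convolution ([gfallD]) adding
    [-1] to the argument [X + 1 - lam] turns the two halves of the sum into
    [(X - lam)_k] and [lam k (X - lam)_(k-1)].  Their sum is
    [(X - lam)_(k-1) (X - k lam + k lam) = X (X - lam)_(k-1) = (X)_k], and the
    uniqueness of coordinates concludes. *)

(** Both the step and the argument live in an arbitrary commutative ring, so
    that scalars such as [(-1)_n] and polynomials such as [(X + 1 - lam)_n]
    are instances of the same product. *)
Definition gfall {A : comNzRingType} (l x : A) n : A :=
  \prod_(i < n) (x - i%:R * l).

Lemma gfall0 (A : comNzRingType) (l x : A) : gfall l x 0 = 1.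
Proof. by rewrite /gfall big_ord0. Qed.

Lemma gfallSr (A : comNzRingType) (l x : A) n :
  gfall l x n.+1 = gfall l x n * (x - n%:R * l).
Proof. by rewrite /gfall big_ord_recr. Qed.

Lemma gfallSl (A : comNzRingType) (l x : A) n :
  gfall l x n.+1 = x * gfall l (x - l) n.
Proof.
rewrite /gfall big_ord_recl /= mul0r subr0; congr (_ * _).
by apply: eq_bigr => i _; rewrite /bump /= add1n -natr1; ring.
Qed.

Lemma rmorph_gfall (A B : comNzRingType) (f : {rmorphism A -> B}) l x n :
  f (gfall l x n) = gfall (f l) (f x) n.
Proof.
rewrite /gfall rmorph_prod; apply: eq_bigr => i _.
by rewrite rmorphB rmorphM rmorph_nat.
Qed.

(** The Vandermonde convolution.  In the inductive step the new factor splits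
    as [x + y - n l = (x - m l) + (y - (n - m) l)], each half extending one of
    the two factorials of the [m]-th term; Pascal's rule recombines them. *)
Lemma gfallD (A : comNzRingType) (l x y : A) n :
  gfall l (x + y) n =
  \sum_(m < n.+1) 'C(n, m)%:R * gfall l x m * gfall l y (n - m).
Proof.
elim: n => [|n IH]; first by rewrite big_ord1 /= !gfall0 bin0 !mulr1.
rewrite gfallSr IH mulr_suml.
transitivity
  (\sum_(m < n.+1) ('C(n, m)%:R * gfall l x m.+1 * gfall l y (n - m))
   + \sum_(m < n.+1) ('C(n, m)%:R * gfall l x m * gfall l y (n.+1 - m))).
  rewrite -big_split; apply: eq_bigr => m _ /=.
  have le_mn : (m <= n)%N by rewrite -ltnS.
  by rewrite subSn // !gfallSr natrB //; ring.
rewrite [RHS]big_ord_recl /=.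
under [X in _ = _ + X]eq_bigr => m _ do
  rewrite /bump /= add1n binS subSS natrD !mulrDl.
rewrite big_split /= addrA [RHS]addrC; congr (_ + _).
(* The term of index [n + 1] may be added to the sum, as 'C(n, n + 1) = 0. *)
transitivity (\sum_(m < n.+2)
    ('C(n, m)%:R * gfall l x m * gfall l y (n.+1 - m))).
  by rewrite [RHS]big_ord_recr /= bin_small // !mul0r addr0.
by rewrite big_ord_recl /= !bin0.
Qed.

Section DegenerateStirlingRecurrence.
Variable R : realType.
Implicit Types (lam : R) (k m n p : nat).

Lemma degfallE lam n : degfall lam n = gfall lam%:P 'X n.
Proof. by apply: eq_bigr => i _; rewrite polyCM polyC_natr. Qed.

Lemma fallpE n : fallp R n = gfall 1 'X n.
Proof. by apply: eq_bigr => i _; rewrite polyC_natr mulr1. Qed.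

Lemma gfallN1 lam n : gfall lam (- 1) n = (-1) ^+ n * degrise lam 1 n.
Proof.
elim: n => [|n IH]; first by rewrite gfall0 /degrise big_ord0 mulr1.
by rewrite gfallSr IH /degrise big_ord_recr /= exprS; ring.
Qed.

Lemma degS2_gt lam n k : (n < k)%N -> degS2 lam n k = 0.
Proof. by move=> lt_nk; rewrite /degS2 insubF // ltnS leqNgt lt_nk. Qed.

(** At [X = 0] only the constant term of the expansion survives. *)
Lemma degS2S0 lam n : degS2 lam n.+1 0 = 0.
Proof.
have /(congr1 (horner_eval 0)) := degS2P lam n.+1.
rewrite degfallE gfallSl big_ord_recl /= /horner_eval hornerM hornerX mul0r.
rewrite hornerD fallpE gfall0 hornerZ hornerC mulr1 horner_sum big1 ?addr0 //.
by move=> i _; rewrite fallpE gfallSl hornerZ hornerM hornerX mul0r mulr0.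
Qed.

(** Whatever the step, [(X)_(p+1)] is [X] times [(X - step)_p], so [X] can be
    cancelled from the expansion of [(X)_(m+1)], which has no constant term.
    The substitution of [X + 1] for [X] then restores the ordinary falling
    factorials.  Letting the sum run up to any [n > m] only adds zeros. *)
Lemma gfall_shift_expansion lam m n : (m < n)%N ->
  gfall lam%:P ('X + 1 - lam%:P) m =
  \sum_(p < n) degS2 lam m.+1 p.+1 *: fallp R p.
Proof.
move=> lt_mn.
have defX : gfall lam%:P ('X - lam%:P) m =
    \sum_(p < m.+1) degS2 lam m.+1 p.+1 *: gfall 1 ('X - 1) p.
  apply: (mulfI (negbT (polyX_eq0 R))).
  rewrite -gfallSl -degfallE degS2P big_ord_recl /= degS2S0 scale0r add0r.
  rewrite mulr_sumr; apply: eq_bigr => p _.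
  by rewrite fallpE gfallSl scalerAr.
have /(congr1 (comp_poly ('X + 1))) := defX.
rewrite rmorph_gfall /= comp_polyB comp_polyX comp_polyC => ->.
rewrite (big_ord_widen n (fun p => degS2 lam m.+1 p.+1 *:
  gfall 1 ('X - 1) p)) // linear_sum big_mkcond /=.
apply: eq_bigr => p _; case: ifPn => [_|]; last first.
  by rewrite -leqNgt => lt_mp; rewrite degS2_gt ?scale0r.
rewrite linearZ /= rmorph_gfall /= comp_polyB comp_polyX -polyC1 comp_polyC.
by rewrite addrK fallpE polyC1.
Qed.

(** The convolution with [(-1)_j] undoes the shift by [1]. *)
Lemma gfall_unshift lam k :
  \sum_(m < k.+1) ('C(k, m)%:R * (-1) ^+ (k - m) * degrise lam 1 (k - m)) *:
     gfall lam%:P ('X + 1 - lam%:P) m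
  = gfall lam%:P ('X - lam%:P) k.
Proof.
have -> : 'X - lam%:P = ('X + 1 - lam%:P) + (- 1)%:P :> {poly R}.
  by rewrite polyCN; ring.
rewrite gfallD; apply: eq_bigr => m _.
rewrite -(rmorph_gfall _ _ (polyC : {rmorphism R -> {poly R}})) gfallN1.
by rewrite -mul_polyC !polyCM polyC_natr; ring.
Qed.

Definition recurrence_weight lam k m : R :=
  'C(k, m)%:R * (-1) ^+ (k - m) * degrise lam 1 (k - m)
  + (if m == k then 0
     else lam * k%:R * 'C(k - 1, m)%:R * (-1) ^+ (k - m - 1)
          * degrise lam 1 (k - m - 1)).

(** The first half of the weights yields [(X - lam)_k]; the second, as
    'C(k, m) is replaced by 'C(k - 1, m), yields [lam k (X - lam)_(k-1)]. *)
Lemma degfall_recurrence lam k :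
  degfall lam k = \sum_(m < k.+1) recurrence_weight lam k m *:
    gfall lam%:P ('X + 1 - lam%:P) m.
Proof.
under eq_bigr do rewrite scalerDl.
rewrite big_split /= gfall_unshift degfallE.
case: k => [|k]; first by rewrite big_ord1 /= scale0r addr0 !gfall0.
rewrite big_ord_recr /= eqxx scale0r addr0.
transitivity (gfall lam%:P ('X - lam%:P) k.+1
  + (lam * k.+1%:R) *: gfall lam%:P ('X - lam%:P) k).
  rewrite gfallSl gfallSr -mul_polyC polyCM polyC_natr -natr1; ring.
congr (_ + _); rewrite -gfall_unshift scaler_sumr; apply: eq_bigr => m _.
rewrite ltn_eqF // subn1 /= -subnDA addnC subnDA subn1 /= scalerA.
by rewrite !mulrA.
Qed.

End DegenerateStirlingRecurrence.

Theorem theorem5 (R : realType) (lam : R) (p k : nat) (hpk : (p <= k)%N) :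
  degS2 lam k p =
  \sum_(p <= m < k.+1)
    ('C(k, m)%:R * (-1) ^+ (k - m) * degrise lam 1 (k - m)
       * degS2 lam m.+1 p.+1
     + (if m == k then 0
        else lam * k%:R * 'C(k - 1, m)%:R * (-1) ^+ (k - m - 1)
               * degrise lam 1 (k - m - 1) * degS2 lam m.+1 p.+1)).
Proof.
pose c q := \sum_(0 <= m < k.+1) recurrence_weight R lam k m * degS2 lam m.+1 q.+1.
have <- : c p = degS2 lam k p.
  apply: degS2_unique hpk; rewrite degfall_recurrence.
  under eq_bigr => m _ do
    rewrite (gfall_shift_expansion _ _ _ _ (ltn_ord m)) scaler_sumr.
  rewrite exchange_big; apply: eq_bigr => q _ /=.
  rewrite /c big_mkord scaler_suml.
  by apply: eq_bigr => m _; rewrite scalerA.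
(* The terms with [m < p] vanish, because then [S(m+1, p+1) = 0]. *)
rewrite /c (big_cat_nat (n := p)) //=; last exact: leqW.
rewrite big_nat big1 ?add0r => [|m lt_mp]; last by rewrite degS2_gt ?mulr0.
apply: eq_bigr => m _; rewrite /recurrence_weight mulrDl.
by case: eqP => // _; rewrite mul0r.
Qed.
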